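(* Let $X$ be a Banach space over $\mathbb{F}$ ($\mathbb{F}=\mathbb{R}$ or $\mathbb{C}$), let $\mathcal{L}$ be a subspace lattice on $X$ such that $\vee\{L:L\in\mathcal{P}_{\mathcal{L}}\}=X$, and let $\delta:\mathrm{Alg}\mathcal{L}\to B(X)$ be a linear mapping. Then $\delta$ satisfies the WJD property if and only if $\delta$ is a generalized derivation and $\delta(I)A\in(\mathrm{Alg}\mathcal{L})'$ for every $A\in\mathrm{Alg}\mathcal{L}$. In particular, if $\delta(I)=0$, then $\delta$ satisfies the WJD property if and only if $\delta$ is a derivation.
   Context: $B(X)$ is the algebra of bounded linear operators on $X$. A subspace of $X$ means a norm-closed linear manifold. A subspace lattice on $X$ is a collection $\mathcal{L}$ of subspaces of $X$ containing $(0)$ and $X$ such that for every family $\{M_r\}$ in $\mathcal{L}$ the intersection $\wedge M_r$ and the closed linear span $\vee M_r$ belong to $\mathcal{L}$ (the closed span of an empty family is $(0)$). $\mathrm{Alg}\mathcal{L}$ is the algebra of operators in $B(X)$ that leave every member of $\mathcal{L}$ invariant, and $(\mathrm{Alg}\mathcal{L})'$ is its commutant in $B(X)$. For $E\in\mathcal{L}$, $E_-=\vee\{F\in\mathcal{L}:F\nsupseteq E\}$, and $\mathcal{P}_{\mathcal{L}}=\{L\in\mathcal{L}:L_-\nsupseteq L\}$. A linear mapping $\delta:\mathrm{Alg}\mathcal{L}\to B(X)$ has the WJD (weak Jordan derivation) property if $\delta(AB+BA)=\delta(A)B+A\delta(B)+\delta(B)A+B\delta(A)$ for all $A,B\in\mathrm{Alg}\mathcal{L}$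 with $AB=0$. It is a derivation if $\delta(AB)=\delta(A)B+A\delta(B)$ for all $A,B$, and a generalized derivation if $\delta(AB)=\delta(A)B+A\delta(B)-A\delta(I)B$ for all $A,B$. *)

(* Defs.v *)
From HB Require Import structures.
From mathcomp Require Import all_boot all_order all_algebra.
From mathcomp Require Import all_classical all_reals topology normedtype.
From mathcomp Require Import complex.

Set Implicit Arguments.
Unset Strict Implicit.
Unset Printing Implicit Defensive.

Import Order.TTheory GRing.Theory Num.Theory.
Import numFieldNormedType.Exports.

Local Open Scope classical_set_scope.
Local Open Scope ring_scope.

Section BoundedOperators.
Variables (F : numFieldType) (X : normedModType F).

Definition is_bounded_op (f : X -> X) : Prop :=
  linear f /\ exists M : F, forall x : X, `|f x| <= M * `|x|.

Definition bounded_op_pred : {pred (X -> X)} := fun f => `[< is_bounded_op f >].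

Record bounded_op : Type := BoundedOp {
  bounded_op_val :> X -> X;
  _ : bounded_op_val \in bounded_op_pred }.

HB.instance Definition _ := [isSub for bounded_op_val].
HB.instance Definition _ := [Choice of bounded_op by <:].

Lemma bounded_opP (A : bounded_op) : is_bounded_op A.
Proof. by case: A => f /= /asboolP. Qed.

Lemma bounded_op_ext (A B : bounded_op) : A =1 B -> A = B.
Proof. by move=> AB; apply: val_inj; apply/funext. Qed.

Fact bounded_op_submod_closed : submod_closed bounded_op_pred.
Proof.
split=> [|a f g /asboolP [lf [M hM]] /asboolP [lg [N hN]]].
  apply/asboolP; split=> [a x y|]; first by rewrite /= scaler0 addr0.
  by exists 0 => x; rewrite /= normr0 mul0r.
apply/asboolP; split.
  move=> b x y; rewrite /= !fctE lf lg !scalerDr !scalerA [a * b]mulrC.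
  by rewrite -!addrA; congr (_ + _); rewrite addrCA.
exists (`|a| * M + N) => x; rewrite !fctE mulrDl.
apply: (le_trans (ler_normD _ _)); apply: lerD => //.
by rewrite normrZ -mulrA ler_wpM2l.
Qed.

HB.instance Definition _ :=
  GRing.isSubmodClosed.Build F (X -> X) bounded_op_pred bounded_op_submod_closed.
HB.instance Definition _ := [SubChoice_isSubLmodule of bounded_op by <:].

Fact bounded_op_id : (id : X -> X) \in bounded_op_pred.
Proof.
apply/asboolP; split => //.
by exists 1 => x; rewrite mul1r.
Qed.

Fact bounded_op_comp (A B : bounded_op) : A \o B \in bounded_op_pred.
Proof.
have [[lA [M hM]] [lB [N hN]]] := (bounded_opP A, bounded_opP B).
apply/asboolP; split=> [a x y|]; first by rewrite /= lB lA.
exists (`|M| * N) => x /=; rewrite -mulrA.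
apply: (le_trans (hM _)).
have [r|nr] := boolP (M \is Num.real).
  apply: (le_trans (ler_wpM2r (normr_ge0 _) (real_ler_norm r))).
  by rewrite ler_wpM2l.
have B0 : `|B x| = 0.
  apply/eqP; apply: contraNT nr => nB.
  have Bp : 0 < `|B x| by rewrite lt_def nB normr_ge0.
  have /ger0_real : 0 <= M * `|B x| by apply: le_trans (hM (B x)).
  by rewrite realrM // ?normr_real // gt_eqF.
by rewrite B0 mulr0 mulr_ge0 // (le_trans _ (hN x)).
Qed.

Definition bounded_op_one : bounded_op := BoundedOp bounded_op_id.
Definition bounded_op_mul (A B : bounded_op) : bounded_op :=
  BoundedOp (bounded_op_comp A B).

Fact bounded_op_mulA : associative bounded_op_mul.
Proof. by move=> A B C; apply: bounded_op_ext. Qed.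
Fact bounded_op_mul1l : left_id bounded_op_one bounded_op_mul.
Proof. by move=> A; apply: bounded_op_ext. Qed.
Fact bounded_op_mul1r : right_id bounded_op_one bounded_op_mul.
Proof. by move=> A; apply: bounded_op_ext. Qed.
Fact bounded_op_mulDl : left_distributive bounded_op_mul +%R.
Proof. by move=> A B C; apply: bounded_op_ext. Qed.
Fact bounded_op_mulDr : right_distributive bounded_op_mul +%R.
Proof.
move=> A B C; apply: bounded_op_ext => x /=.
have [lA _] := bounded_opP A.
by have := lA 1 (B x) (C x); rewrite !scale1r.
Qed.

(* The product is composition; 1 = 0 is possible since X may be trivial. *)
HB.instance Definition _ := GRing.Zmodule_isPzRing.Build bounded_op
  bounded_op_mulA bounded_op_mul1l bounded_op_mul1r
  bounded_op_mulDl bounded_op_mulDr.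

End BoundedOperators.

Section SubspaceLattices.
Variables (F : numFieldType) (X : normedModType F).

Definition is_subspace (M : set X) : Prop :=
  [/\ closed M, M 0 & forall (a : F) (x y : X), M x -> M y -> M (a *: x + y)].

Definition closed_span (A : set X) : set X :=
  closure [set x | exists n (c : 'I_n -> F) (v : 'I_n -> X),
    (forall i, A (v i)) /\ x = \sum_(i < n) c i *: v i].

(* A family of members of L is represented by its set of members; for the empty
   family the intersection is X and the closed span is {0}. *)
Record subspace_lattice : Type := SubspaceLattice {
  members : set (set X);
  lattice_subspace : members `<=` is_subspace;
  lattice_zero : members [set 0];
  lattice_full : members setT;
  lattice_meet : forall G : set (set X),
    G `<=` members -> members (\bigcap_(M in G) M);
  lattice_join : forall G : set (set X),
    G `<=` members -> members (closed_span (\bigcup_(M in G) M)) }.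

Variable L : subspace_lattice.

(* E_- *)
Definition lower (E : set X) : set X :=
  closed_span (\bigcup_(M in [set M | members L M /\ ~ (E `<=` M)]) M).

(* P_L *)
Definition PL : set (set X) := [set M | members L M /\ ~ (M `<=` lower M)].

Definition Alg : {pred (bounded_op X)} :=
  fun A => `[< forall M, members L M -> forall x, M x -> M (A x) >].

Record alg_op : Type := AlgOp {
  alg_op_val :> bounded_op X;
  _ : alg_op_val \in Alg }.

HB.instance Definition _ := [isSub for alg_op_val].
HB.instance Definition _ := [Choice of alg_op by <:].

Fact Alg_submod_closed : submod_closed Alg.
Proof.
split=> [|a A B /asboolP hA /asboolP hB]; apply/asboolP => M LM x Mx.
  by have [_ M0 _] := lattice_subspace LM.
by have [_ _ Mlin] := lattice_subspace LM; apply: Mlin; [apply: hA|apply: hB].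
Qed.

HB.instance Definition _ :=
  GRing.isSubmodClosed.Build F (bounded_op X) Alg Alg_submod_closed.

HB.instance Definition _ := [SubChoice_isSubLmodule of alg_op by <:].

Fact Alg_subring_closed : subring_closed Alg.
Proof.
split=> [|A B AA AB|A B /asboolP hA /asboolP hB]; last 1 first.
- by apply/asboolP => M LM x Mx; apply: hA => //; apply: hB.
- by apply/asboolP => M LM x Mx.
- exact: rpredB.
Qed.

HB.instance Definition _ := GRing.SubZmodule_isSubPzRing.Build
  (bounded_op X) Alg alg_op Alg_subring_closed.

End SubspaceLattices.

Definition commutant (F : numFieldType) (X : normedModType F)
    (S : {pred (bounded_op X)}) : set (bounded_op X) :=
  [set T | forall C, C \in S -> T * C = C * T].

Section Derivations.
Variables (F : numFieldType) (X : normedModType F) (L : subspace_lattice X).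
Variable delta : alg_op L -> bounded_op X.

Definition WJD : Prop := forall A B : alg_op L, A * B = 0 ->
  delta (A * B + B * A) =
    delta A * \val B + \val A * delta B + delta B * \val A + \val B * delta A.

Definition derivation : Prop := forall A B : alg_op L,
  delta (A * B) = delta A * \val B + \val A * delta B.

Definition generalized_derivation : Prop := forall A B : alg_op L,
  delta (A * B) =
    delta A * \val B + \val A * delta B - \val A * delta 1 * \val B.

End Derivations.

(* Main.v *)
(* Fix E in P_L. Hahn-Banach gives a bounded functional f vanishing on E_- and
   not on E, and then x (x) f lies in Alg L for every x in E. These elementary
   operators form a left ideal spanned by rank-one idempotents, and as the
   members of P_L span X, an operator T with T S = 0 for all elementary S is 0.

   Write D = delta(1). For an idempotent P, applying WJD to the zero products
   (AP)(1-P) and (A(1-P))P computes the Jordan form of (A, P); comparing with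
   the products P((1-P)A) and (1-P)(PA) yields DAP = DPA, which extends
   linearly to D A S = D S A = S D A for S elementary. Hence
   D A C S = D (C S) A = C S D A = C D A S, i.e. DA is in the commutant.
   Then A |-> delta(A) - D A has WJD and kills 1. After subtracting an inner
   derivation it also kills a given rank-one idempotent P; applying WJD to the
   square-zero elements (1-P)AP and PA(1-P) shows that it preserves these Peirce
   corners, because rank-one idempotents are prime. So the generalized
   derivation identity holds for (A, P), hence for (A, S) with S elementary, and
   associativity in (AB)S = A(BS) transfers it to all pairs (A, B). *)
Require Import Defs.
From HB Require Import structures.
From mathcomp Require Import all_boot all_order all_algebra.
From mathcomp Require Import all_classical all_reals topology normedtype.
From mathcomp Require Import complex.
From mathcomp Require Import ring lra.
From Stdlib Require Import -(notations) Ncring Ncring_tac.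

Import Order.TTheory GRing.Theory Num.Theory.
Import numFieldNormedType.Exports.

Local Open Scope classical_set_scope.
Local Open Scope ring_scope.
Local Open Scope complex_scope.

(** * Hahn-Banach separation *)

Section HahnBanach.
Context {R : realType} {V : lmodType R}.
Variable p : V -> R.
Hypothesis pD : forall x y, p (x + y) <= p x + p y.
Hypothesis pZ : forall t x, 0 < t -> p (t *: x) = t * p x.

Definition linear_graph (G : set (V * R)) : Prop :=
  forall t x y r s, G (x, r) -> G (y, s) -> G (t *: x + y, t * r + s).

Definition dominated_graph (G : set (V * R)) : Prop :=
  forall x r, G (x, r) -> r <= p x.

(** Domination forces single-valuedness: linearity puts [(0, s - r)] and [(0, r - s)] in [G], and
    [p 0 = 0] bounds both values by 0. *)
Lemma linear_graph_inj G x r s : linear_graph G -> dominated_graph G ->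
  G (x, r) -> G (x, s) -> r = s.
Proof.
move=> Glin Gdom Gr Gs.
have p0 : p 0 = 0.
  by have := pZ 2 0 (ltr0Sn _ 1); rewrite scaler0; lra.
have le0 u v : G (x, u) -> G (x, v) -> v - u <= 0.
  move=> Gu Gv; have := Gdom _ _ (Glin (-1) _ _ _ _ Gu Gv).
  by rewrite scaleN1r addNr p0 mulN1r addrC.
by have := le0 _ _ Gr Gs; have := le0 _ _ Gs Gr; lra.
Qed.

(** The value [c] at [v] has to lie above every [r - p (x - v)] and below every [p (y + v) - s].
    Subadditivity makes these bounds compatible, so the supremum of the lower ones serves. *)
Lemma extend_graph G v : G (0, 0) -> linear_graph G -> dominated_graph G ->
  exists c, dominated_graph [set z | exists x r t,
    G (x, r) /\ z = (x + t *: v, r + t * c)].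
Proof.
move=> G0 Glin Gdom.
have bnd x r y s : G (x, r) -> G (y, s) -> r - p (x - v) <= p (y + v) - s.
  move=> Gx Gy; have := Glin 1 _ _ _ _ Gx Gy.
  rewrite scale1r mul1r => /Gdom rs.
  have := pD (x - v) (y + v).
  rewrite addrACA addNr addr0; lra.
pose S := [set b | exists x r, G (x, r) /\ b = r - p (x - v)].
have S0 : S !=set0 by exists (0 - p (0 - v)), 0, 0.
have ubS y s : G (y, s) -> ubound S (p (y + v) - s).
  by move=> Gy _ [x [r [Gx ->]]]; apply: bnd.
have Ssup : has_sup S by split=> //; exists (p (0 + v) - 0); apply: ubS.
have GZ t x r : G (x, r) -> G (t *: x, t * r).
  by move=> Gx; have := Glin t _ _ _ _ Gx G0; rewrite !addr0.
exists (sup S) => _ _ [x [r [t [Gx [-> ->]]]]].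
have [t_lt0|t_gt0|->] := ltgtP t 0; last by rewrite scale0r mul0r !addr0; exact: Gdom.
- have Nt : 0 < - t by rewrite oppr_gt0.
  have /(sup_upper_bound Ssup) : S ((- t)^-1 * r - p ((- t)^-1 *: x - v)).
    by exists ((- t)^-1 *: x), ((- t)^-1 * r); split=> //; apply: GZ.
  rewrite -(ler_pM2l Nt) mulrBr mulrA mulfV ?gt_eqF// mul1r.
  by rewrite -pZ// scalerBr scalerA mulfV ?gt_eqF// scale1r scaleNr opprK; lra.
- have : sup S <= p (t^-1 *: x + v) - t^-1 * r by apply/ge_sup/ubS/GZ.
  rewrite -(ler_pM2l t_gt0) mulrBr mulrA mulfV ?gt_eqF// mul1r.
  by rewrite -pZ// scalerDr scalerA mulfV ?gt_eqF// scale1r; lra.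
Qed.

Lemma hahn_banach_graph (G0 : set (V * R)) :
    G0 (0, 0) -> linear_graph G0 -> dominated_graph G0 ->
  exists f : V -> R, [/\ forall t x y, f (t *: x + y) = t * f x + f y,
    forall x, f x <= p x & forall x r, G0 (x, r) -> f x = r].
Proof.
move=> G00 G0lin G0dom.
(* Zorn_bigcup also requires the empty union to be good, hence [G0 `|` G]. *)
pose good := [set G | linear_graph (G0 `|` G) /\ dominated_graph (G0 `|` G)].
have [F Fgood Ftot|G [[Glin Gdom] Gmax]] := @Zorn_bigcup (V * R)%type good.
  split; last first.
    move=> x r [/G0dom //|[G FG Gx]].
    by have [_] := Fgood _ FG; apply; right.
  move=> t x y r s.
  have G0F H : F H -> G0 `|` H `<=` G0 `|` \bigcup_(G in F) G.
    by move=> FH; apply: setUS; apply: bigcup_sup.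
  move=> [Gx|[G FG Gx]] [Gy|[H FH Gy]].
  - by left; apply: G0lin.
  - by apply: (G0F _ FH); have [+ _] := Fgood _ FH; apply; [left|right].
  - by apply: (G0F _ FG); have [+ _] := Fgood _ FG; apply; [right|left].
  have [GH|HG] := Ftot _ _ FG FH.
  - by apply: (G0F _ FH); have [+ _] := Fgood _ FH; apply; right => //; exact: GH.
  - by apply: (G0F _ FG); have [+ _] := Fgood _ FG; apply; right => //; exact: HG.
set H := G0 `|` G in Glin Gdom.
have H0 : H (0, 0) by left.
have Htotal v : exists r, H (v, r).
  have [c] := extend_graph _ v H0 Glin Gdom.
  set E := [set z | _] => Edom.
  have HE : H `<=` E.
    by move=> [x r] Hx; exists x, r, 0; rewrite scale0r mul0r !addr0.
  have EE : G0 `|` E = E.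
    by apply/setUidPr => z Gz; apply: HE; left.
  have Egood : good E.
    split; rewrite EE // => t _ _ _ _ [x [r [a [Hx [-> ->]]]]] [y [s [b [Hy [-> ->]]]]].
    exists (t *: x + y), (t * r + s), (t * a + b).
    split; first exact: Glin.
    rewrite !scalerDr !scalerDl !scalerA; congr pair; last by ring.
    by rewrite -!addrA; congr (_ + _); rewrite addrCA.
  have GE : G `<=` E by move=> z Gz; apply: HE; right.
  (* Maximality: a good set containing [G] lies inside [G], so [(v, c)] is already in [G]. *)
  have EG : E `<=` G.
    apply: contrapT => nEG; apply: (Gmax E) => //.
  exists c; right; apply: EG; exists 0, 0, 1.
  by rewrite scale1r mul1r !add0r.
have [f fH] := choice Htotal.
exists f; split=> [t x y|x|x r G0x].
- by apply: (linear_graph_inj _ _ _ _ Glin Gdom (fH _)); apply: Glin.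
- exact/Gdom/fH.
- by apply: (linear_graph_inj _ _ _ _ Glin Gdom (fH _)); left.
Qed.

End HahnBanach.

(** Hahn-Banach extends [m + t *: x0 |-> t] from the span of [M] and [x0], dominated there by
    [d^-1 * N] because [x0] stays at distance at least [d] from [M]. *)
Lemma seminorm_separation (R : realType) (V : lmodType R) (N : V -> R)
    (M : set V) (x0 : V) (d : R) :
    (forall x y, N (x + y) <= N x + N y) ->
    (forall t x, N (t *: x) = `|t| * N x) ->
    M 0 -> (forall t x y, M x -> M y -> M (t *: x + y)) ->
    0 < d -> (forall m, M m -> d <= N (x0 + m)) ->
  exists f : V -> R, [/\ forall t x y, f (t *: x + y) = t * f x + f y,
    forall x, d * `|f x| <= N x, forall m, M m -> f m = 0 & f x0 = 1].
Proof.
move=> ND NZ M0 Mlin d0 Md.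
have dV : 0 <= d^-1 by rewrite invr_ge0 ltW.
pose G0 : set (V * R) := [set z | exists m t, M m /\ z = (m + t *: x0, t)].
have N_ge0 x : 0 <= N x.
  have N0 : N 0 = 0 by have := NZ 0 0; rewrite normr0 mul0r scale0r.
  have NN : N (- x) = N x by rewrite -scaleN1r NZ normrN1 mul1r.
  by have := ND x (- x); rewrite subrr N0 NN; lra.
have [||||_ _ [m [t [Mm [-> ->]]]]|f [flin fN fG0]] :=
    @hahn_banach_graph R V (fun x => d^-1 * N x) _ _ G0.
- by move=> x y; rewrite -mulrDr ler_wpM2l.
- by move=> t x t0; rewrite NZ gtr0_norm // mulrCA.
- by exists 0, 0; rewrite scale0r addr0.
- move=> t _ _ _ _ [m [a [Mm [-> ->]]]] [n [b [Mn [-> ->]]]].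
  exists (t *: m + n), (t * a + b); split; first exact: Mlin.
  congr pair; rewrite scalerDr scalerDl scalerA.
  by rewrite -!addrA; congr (_ + _); rewrite addrCA.
- rewrite ler_pdivlMl //.
  have [->|t_neq0] := eqVneq t 0; first by rewrite mulr0 N_ge0.
  suff dt : d * `|t| <= N (m + t *: x0).
    by apply: le_trans dt; rewrite ler_pM2l // ler_norm.
  (* The summand 0 gives the vector the shape that [Mlin] recognises as a member of [M]. *)
  have -> : m + t *: x0 = t *: (x0 + (t^-1 *: m + 0)).
    by rewrite addr0 scalerDr scalerA mulfV // scale1r addrC.
  rewrite NZ mulrC ler_pM2l ?normr_gt0 //.
  exact/Md/Mlin.
exists f; split=> // [x|m Mm|]; last 2 first.
- by apply: fG0; exists m, 0; rewrite scale0r addr0.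
- by apply: fG0; exists 0, 1; rewrite scale1r add0r.
rewrite mulrC -ler_pdivlMr // mulrC ler_norml fN andbT.
have fN1 : f (- x) = - f x.
  have := flin (-1) x 0; have := flin 1 0 0.
  by rewrite scale1r scaleN1r !addr0; lra.
by have := fN (- x); rewrite fN1 -scaleN1r NZ normrN1 mul1r lerNl.
Qed.

(** Separation is isolated as a property of the scalar field: it is proved for real and complex
    scalars separately, and everything after it is uniform in [F]. *)
Definition functional_separation (F : numFieldType) : Prop :=
  forall (X : normedModType F) (M : set X) (x0 : X),
    is_subspace M -> ~ M x0 ->
  exists f : X -> F, [/\ forall a x y, f (a *: x + y) = a * f x + f y,
    exists K, forall x, `|f x| <= K * `|x|, forall m, M m -> f m = 0 & f x0 = 1].

(** The bound is a negated strict inequality because the order of a [numFieldType] is only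
    partial. *)
Lemma closed_subspace_dist (F : numFieldType) (X : normedModType F)
    (M : set X) (x0 : X) : is_subspace M -> ~ M x0 ->
  exists2 d : F, 0 < d & forall m, M m -> ~ (`|x0 + m| < d).
Proof.
move=> [Mcl M0 Mlin] nMx0.
have : nbhs x0 (~` M) by apply: open_nbhs_nbhs; split=> //; exact: closed_openC.
move=> /nbhs_ballP[d d0 dM]; exists d => // m Mm dm.
apply: (dM (- m)).
  by rewrite -ball_normE /= opprK.
by have := Mlin (-1) _ _ Mm M0; rewrite scaleN1r addr0.
Qed.

Lemma functional_separation_real (R : realType) : functional_separation R.
Proof.
move=> X M x0 sM nMx0.
have [d d0 dM] := closed_subspace_dist _ _ _ _ sM nMx0.
have [_ M0 Mlin] := sM.
have [||m Mm|f [flin fd fM fx0]] :=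
    @seminorm_separation R X (fun x => `|x|) M x0 d _ _ M0 Mlin d0 _.
- exact: ler_normD.
- exact: normrZ.
- by rewrite leNgt; apply/negP/dM.
exists f; split=> //; exists d^-1 => x.
by rewrite ler_pdivlMl.
Qed.

(** * Separation over the complex numbers by restriction to real scalars *)

Section ComplexSeparation.
Context {R : realType} {V : lmodType R[i]}.

Definition realified : Type := V.
HB.instance Definition _ := GRing.Zmodule.on realified.

Definition realified_scale (t : R) (v : realified) : realified :=
  (t%:C *: (v : V)).

Fact realified_scaleA a b v :
  realified_scale a (realified_scale b v) = realified_scale (a * b) v.
Proof. by rewrite /realified_scale scalerA rmorphM. Qed.

Fact realified_scale1 : left_id 1 realified_scale.
Proof. by move=> v; exact: scale1r. Qed.

Fact realified_scaleDr : right_distributive realified_scale +%R.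
Proof. by move=> a u v; exact: scalerDr. Qed.

Fact realified_scaleDl v : {morph realified_scale^~ v : a b / a + b}.
Proof. by move=> a b; rewrite /realified_scale rmorphD scalerDl. Qed.

HB.instance Definition _ := GRing.Zmodule_isLmodule.Build R realified
  realified_scaleA realified_scale1 realified_scaleDr realified_scaleDl.

End ComplexSeparation.
Arguments realified {R} V.

Lemma functional_separation_complex (R : realType) : functional_separation R[i].
Proof.
move=> X M x0 sM nMx0.
have [d d0 dM] := closed_subspace_dist _ _ _ _ sM nMx0.
have [_ M0 Mlin] := sM.
have realE (z : R[i]) : 0 <= z -> z = (complex.Re z)%:C.
  by case: z => a b; rewrite lecE /= => /andP[/eqP -> _].
have d0' : 0 < complex.Re d by move: d0; rewrite ltcE /= => /andP[].
pose N (x : realified X) : R := complex.Re `|x : X|.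
have NE (x : X) : `|x| = (N x)%:C by apply: realE.
have [x y|t x||m Mm|f [flin fd fM fx0]] :=
    @seminorm_separation R (realified X) N M x0 (complex.Re d) _ _ M0 _ d0' _.
- by have := ler_normD (x : X) (y : X); rewrite !NE -rmorphD lecR.
- have : `|t%:C *: (x : X)| = `|t%:C| * `|x : X| := normrZ _ _.
  by rewrite normc_def /= expr0n addr0 sqrtr_sqr !NE -rmorphM => /complexI.
- by move=> t x y; exact: Mlin.
- rewrite leNgt; apply/negP => ?; apply: (dM m Mm).
  by rewrite NE (realE d (ltW d0)) ltcR.
have fD (x y : X) : f (x + y) = f x + f y.
  by have := flin 1 x y; rewrite !scale1r mul1r.
have fZ (t : R) (x : X) : f (t%:C *: x) = t * f x.
  have f0 : f 0 = 0 by have := fD 0 0; rewrite addr0; lra.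
  by have := flin t x 0; rewrite f0 !addr0.
(* The complex-linear functional with real part [f]. Its value at [x0] has real part 1 but need not
   equal 1, hence the final division by [g x0]. *)
pose g (x : X) : R[i] := (f x)%:C - 'i * (f ('i *: x))%:C.
have gD x y : g (x + y) = g x + g y.
  by rewrite /g scalerDr !fD !rmorphD /=; ring.
have gR (t : R) x : g (t%:C *: x) = t%:C * g x.
  by rewrite /g scalerA [_ * t%:C]mulrC -scalerA !fZ !rmorphM /=; ring.
have gI x : g ('i *: x) = 'i * g x.
  rewrite /g scalerA -expr2 sqr_i.
  have -> : -1 = (-1)%:C :> R[i] by rewrite rmorphN rmorph1.
  rewrite fZ mulN1r rmorphN /= mulrBr mulrA -expr2 sqr_i; ring.
have gZ a x : g (a *: x) = a * g x.
  by rewrite [a]complexE scalerDl gD -scalerA gI !gR mulrDl mulrA.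
have Ni : `|'i : R[i]| = 1 by rewrite normc_def /= expr0n expr1n add0r sqrtr1.
have gx0 : g x0 != 0.
  apply/eqP => /(congr1 (@complex.Re R)).
  have -> : complex.Re (g x0) = f x0 by rewrite /g /=; ring.
  by rewrite fx0 => /eqP; rewrite oner_eq0.
have gN x : d * `|g x| <= 2 * `|x|.
  have fN (y : X) : d * `|(f y)%:C| <= `|y|.
    rewrite (realE d (ltW d0)) normc_def /= expr0n addr0 sqrtr_sqr NE.
    by rewrite -rmorphM lecR.
  have -> : 2 * `|x| = `|x| + `|'i *: x|.
    by rewrite normrZ Ni mul1r; ring.
  apply: le_trans (lerD (fN _) (fN _)).
  rewrite -mulrDr ler_pM2l //; apply: le_trans (ler_normB _ _) _.
  by rewrite normrM Ni mul1r.
exists (fun x => g x / g x0); split.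
- by move=> a x y; rewrite gD gZ mulrDl mulrA.
- exists (d^-1 * 2 / `|g x0|) => x.
  rewrite normrM normfV [X in _ <= X]mulrAC ler_pM2r ?invr_gt0 ?normr_gt0 //.
  by rewrite -mulrA ler_pdivlMl //; exact: gN.
- move=> m Mm; have Mim : M ('i *: m).
    by have := Mlin 'i _ _ Mm M0; rewrite addr0.
  by rewrite /g (fM _ Mm) (fM _ Mim) mulr0 subr0 mul0r.
- by rewrite divff.
Qed.

(** * Weak Jordan derivations and idempotents *)

Section NonCommutativeRing.
Variable V : pzRingType.

(** These instances make the tactic [non_commutative_ring] available in every [pzRingType]. *)
#[local] Instance pzring_ops : @Ring_ops V (0 : V) (1 : V)
  +%R *%R (fun x y : V => x - y) -%R (@eq V) := {}.

#[local] Instance pzring_ring : Ring (Ro := pzring_ops).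
Proof.
split; try exact _.
- exact: add0r.
- exact: addrC.
- exact: addrA.
- exact: mul1r.
- exact: mulr1.
- exact: mulrA.
- by move=> x y z; exact: mulrDl.
- by move=> x y z; exact: mulrDr.
- by [].
- exact: subrr.
Qed.
End NonCommutativeRing.
#[local] Existing Instance pzring_ops.
#[local] Existing Instance pzring_ring.

(** Reduces an equation that follows linearly from a known one to a ring identity, left to
    [non_commutative_ring]. *)
Lemma eq_of_subr (V : zmodType) (a b x y : V) : a = b -> x - y = a - b -> x = y.
Proof. by move=> ->; rewrite subrr => /eqP; rewrite subr_eq0 => /eqP. Qed.

Lemma generalized_derivation_defect (V : pzRingType) (dab da db ds a b s D : V) :
    dab * s + a * b * ds - a * b * D * s =
      da * (b * s) + a * (db * s + b * ds - b * D * s) - a * D * (b * s) ->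
  (dab - (da * b + a * db - a * D * b)) * s = 0.
Proof.
by move=> e; apply: (eq_of_subr _ _ _ _ _ e); non_commutative_ring.
Qed.

Section WeakJordan.
Context {U V : pzRingType} (iota : {rmorphism U -> V}).
Hypothesis V2 : forall v : V, v + v = 0 -> v = 0.
Hypothesis iota_inj : injective iota.

(** [U] and [V] model [Alg L] and the bounded operators, with [iota] the inclusion; the arguments
    below are purely ring-theoretic. *)
Definition jordan_form (delta : U -> V) (A B : U) : V :=
  delta A * iota B + iota A * delta B + delta B * iota A + iota B * delta A.

Definition weak_jordan (delta : U -> V) : Prop :=
  forall A B, A * B = 0 -> delta (A * B + B * A) = jordan_form delta A B.

Section Idempotents.
Variable delta : U -> V.
Hypothesis deltaB : {morph delta : A B / A - B}.
Hypothesis wjd : weak_jordan delta.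
Let D := delta 1.
Let phi := jordan_form delta.

Let delta0 : delta 0 = 0.
Proof. by have := deltaB 0 0; rewrite !subrr. Qed.

Let phiBl A B C : phi (A - B) C = phi A C - phi B C.
Proof. by rewrite /phi /jordan_form deltaB rmorphB; non_commutative_ring. Qed.

Let phiBr A B C : phi C (A - B) = phi C A - phi C B.
Proof. by rewrite /phi /jordan_form deltaB rmorphB; non_commutative_ring. Qed.

Let phiC A B : phi A B = phi B A.
Proof. by rewrite /phi /jordan_form; non_commutative_ring. Qed.

Let phi1 A : phi A 1 = delta A + delta A + D * iota A + iota A * D.
Proof. by rewrite /phi /jordan_form rmorph1 -/D; non_commutative_ring. Qed.

Let wjdE A B : A * B = 0 -> delta (B * A) = phi A B.
Proof. by move=> AB; rewrite -[phi _ _]wjd // AB add0r. Qed.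

(** The zero products [(A P)(1 - P)] and [(A (1 - P)) P] both involve [phi (A P) P], which cancels
    in their difference. *)
Lemma weak_jordan_idemr A P : P * P = P ->
  jordan_form delta A P =
    delta (A * P) + delta (P * A) + (D * iota (A * P) + iota (A * P) * D).
Proof.
move=> PP.
have e1 : A * P * (1 - P) = 0 by rewrite mulrBr mulr1 -mulrA PP subrr.
have e2 : A * (1 - P) * P = 0 by rewrite -mulrA mulrBl mul1r PP subrr mulr0.
move: (wjdE _ _ e1) (wjdE _ _ e2).
rewrite mulrBl mul1r !mulrBr mulr1 !deltaB phiBr phiBl phi1 mulrA -/(phi A P).
move=> {}e1 {}e2.
by apply: (eq_of_subr _ _ _ _ _ (congr2 (fun u v => u - v) e1 e2)); non_commutative_ring.
Qed.

(** The mirrored zero products evaluate the same form with [P A] in place of [A P]; the two values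
    must agree. *)
Lemma weak_jordan_idem_swap A P : P * P = P ->
  D * iota (A * P) + iota (A * P) * D = D * iota (P * A) + iota (P * A) * D.
Proof.
move=> PP.
have e1 : P * ((1 - P) * A) = 0 by rewrite mulrA mulrBr mulr1 PP subrr mul0r.
have e2 : (1 - P) * (P * A) = 0 by rewrite mulrA mulrBl mul1r PP subrr mul0r.
move: (wjdE _ _ e1) (wjdE _ _ e2).
rewrite !(mulrBl, mulrBr) !mul1r mulr1 !deltaB phiBr phiBl phiC.
rewrite [phi 1 _]phiC phi1 -!mulrA [phi A P]weak_jordan_idemr //.
move=> {}e1 {}e2.
by apply: (eq_of_subr _ _ _ _ _ (congr2 (fun u v => v - u) e1 e2)); non_commutative_ring.
Qed.

Lemma weak_jordan_idem_square P : P * P = P ->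
  delta P * iota P + iota P * delta P + (delta P * iota P + iota P * delta P) =
    delta P + delta P + (D * iota P + iota P * D).
Proof.
move=> PP; have := weak_jordan_idemr P P PP; rewrite /jordan_form PP => e.
by apply: (eq_of_subr _ _ _ _ _ e); non_commutative_ring.
Qed.

(** With [p = iota P], multiplying the square identity by [p] on the left and on the right expresses
    [2 p delta(P) p] as [p D p + p D] and as [p D p + D p]. *)
Lemma weak_jordan_idem_comm P : P * P = P -> D * iota P = iota P * D.
Proof.
move=> PP; have pp : iota P * iota P = iota P by rewrite -rmorphM PP.
have ppr x : x * iota P * iota P = x * iota P by rewrite -mulrA pp.
have e := weak_jordan_idem_square P PP.
have := congr1 (fun x => x * iota P) e; have := congr1 ( *%R (iota P)) e.
rewrite /= !(mulrDr, mulrDl) !mulrA !(pp, ppr) => el er.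
by apply: (eq_of_subr _ _ _ _ _ (congr2 (fun u v => u - v) el er)); non_commutative_ring.
Qed.

(** [A P] and [P A] differ only in the corners [a = P A (1 - P)] and [b = (1 - P) A P]. As [P + a]
    and [P + b] are idempotent, [D] commutes with both corners, while the swap identity makes it
    anticommute with them; so [D] kills them. *)
Lemma weak_jordan_corner_comm A P : P * P = P ->
  D * iota (A * P) = D * iota (P * A).
Proof.
move=> PP.
have ppr x : x * P * P = x * P by rewrite -mulrA PP.
pose a := P * A - P * A * P; pose b := A * P - P * A * P.
have aP : a * P = 0 by rewrite mulrBl ppr subrr.
have Pa : P * a = a by rewrite mulrBr !mulrA PP.
have bP : b * P = b by rewrite mulrBl !ppr.
have Pb : P * b = 0 by rewrite mulrBr !mulrA PP subrr.
have aE : P * A = P * A * P + a by rewrite addrC subrK.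
have bE : A * P = P * A * P + b by rewrite addrC subrK.
clearbody a b.
have comm0 x : iota x * D = D * iota x -> D * iota x + iota x * D = 0 ->
    D * iota x = 0.
  by move=> -> /V2.
have DC x : (P + x) * (P + x) = P + x -> iota x * D = D * iota x.
  move=> /weak_jordan_idem_comm; rewrite rmorphD mulrDr mulrDl.
  by rewrite weak_jordan_idem_comm // => /addrI ->.
have Da : D * iota a = 0.
  apply: comm0.
    apply: DC; rewrite mulrDl !mulrDr PP Pa aP -[X in a * X]Pa mulrA aP.
    by rewrite mul0r !addr0.
  have := weak_jordan_idem_swap a P PP.
  by rewrite aP Pa rmorph0 mulr0 mul0r addr0.
have Db : D * iota b = 0.
  apply: comm0.
    apply: DC; rewrite mulrDl !mulrDr PP Pb bP -[X in X * b]bP -mulrA Pb.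
    by rewrite mulr0 !addr0.
  have := weak_jordan_idem_swap b P PP.
  by rewrite bP Pb rmorph0 mulr0 mul0r addr0.
by rewrite aE bE !rmorphD !mulrDr Da Db.
Qed.

End Idempotents.

(** Rank-one operators have this property: if [p] is [x (x) f], then [u p v] is
    [u x (x) (f o v)]. *)
Definition prime_element (p : V) : Prop :=
  forall u v : V, u * p * v = 0 -> u * p = 0 \/ p * v = 0.

Lemma weak_jordan_peirce (delta : U -> V) P A :
    {morph delta : A B / A - B} -> weak_jordan delta ->
    P * P = P -> prime_element (iota P) -> delta 1 = 0 -> delta P = 0 ->
  delta (A * P) = delta A * iota P.
Proof.
move=> deltaB wjd PP primeP d1 dP.
set p := iota P.
have pp : p * p = p by rewrite -rmorphM PP.
have ppr x : x * p * p = x * p by rewrite -mulrA pp.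
have PPr x : x * P * P = x * P by rewrite -mulrA PP.
have delta0 : delta 0 = 0 by have := deltaB 0 0; rewrite !subrr.
have deltaD x y : delta (x + y) = delta x + delta y.
  by rewrite -{1}[y]opprK -[- y]sub0r !deltaB delta0 sub0r opprK.
have J x : delta (x * P) + delta (P * x) = delta x * p + p * delta x.
  have := weak_jordan_idemr _ deltaB wjd x P PP.
  by rewrite /jordan_form dP d1 !(mulr0, mul0r, addr0, add0r).
have sq0 x : x * x = 0 -> delta x * iota x + iota x * delta x = 0.
  move=> xx; apply: V2; have := wjd _ _ xx.
  by rewrite xx addr0 delta0 /jordan_form addrA => <-.
pose x := P * A * P; pose a := P * A - x; pose b := A * P - x.
pose c := A - P * A - b.
have xP : x * P = x by rewrite PPr.
have Px : P * x = x by rewrite !mulrA PP.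
have aP : a * P = 0 by rewrite mulrBl PPr subrr.
have Pa : P * a = a by rewrite mulrBr Px mulrA PP.
have bP : b * P = b by rewrite mulrBl PPr xP.
have Pb : P * b = 0 by rewrite mulrBr Px mulrA subrr.
have cP : c * P = 0 by rewrite mulrBl bP mulrBl -/x -/b subrr.
have Pc : P * c = 0 by rewrite mulrBr Pb mulrBr mulrA PP subrr subr0.
(* Peirce decomposition. It remains to show that right multiplication by [p] fixes [delta x] and
   [delta b] and kills [delta a] and [delta c]. *)
have AE : A = x + a + b + c.
  by rewrite [x + a]addrC /a subrK /c -[A - _ - _]addrA -opprD [A - _]addrC addrA subrr add0r.
have APE : A * P = x + b by rewrite addrC /b subrK.
clearbody x a b c.
have ia : p * iota a = iota a by rewrite -rmorphM Pa.
have iap : iota a * p = 0 by rewrite -rmorphM aP rmorph0.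
have ib : iota b * p = iota b by rewrite -rmorphM bP.
have pib : p * iota b = 0 by rewrite -rmorphM Pb rmorph0.
have da : delta a * p = 0.
  have Ja := J a; rewrite aP Pa delta0 add0r in Ja.
  have aa : a * a = 0 by rewrite -[X in a * X]Pa mulrA aP mul0r.
  have ada : iota a * delta a = 0.
    have := congr1 ( *%R^~ p) (sq0 a aa).
    rewrite /= mulrDl -mulrA iap mulr0 add0r mul0r => adap.
    by rewrite Ja mulrDr !mulrA iap mul0r addr0.
  (* Now [delta a * p * iota a = 0], so primeness gives the claim unless [a = 0]. *)
  have := sq0 a aa; rewrite ada addr0 -ia mulrA => /primeP[//|].
  rewrite ia => ia0; suff -> : a = 0 by rewrite delta0 mul0r.
  by apply: iota_inj; rewrite ia0 rmorph0.
have Jb := J b; rewrite bP Pb delta0 addr0 in Jb.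
have db : p * delta b = 0.
  have bb : b * b = 0 by rewrite -[X in X * b]bP -mulrA Pb mulr0.
  have dbb : delta b * iota b = 0.
    have := congr1 ( *%R p) (sq0 b bb).
    rewrite /= mulrDr [X in _ + X]mulrA pib mul0r addr0 mulr0 => pdbb.
    by rewrite Jb mulrDl -mulrA pib mulr0 add0r -mulrA.
  have := sq0 b bb; rewrite dbb add0r -ib => /primeP[|//].
  rewrite ib => ib0; suff -> : b = 0 by rewrite delta0 mulr0.
  by apply: iota_inj; rewrite ib0 rmorph0.
have dbp : delta b * p = delta b by rewrite [RHS]Jb db addr0.
have dc : delta c * p = 0.
  have := J c; rewrite cP Pc delta0 addr0 => Jc.
  have pdcp : p * delta c * p = 0.
    apply: V2; have := congr1 (fun y => p * y * p) Jc.
    by rewrite /= mulr0 mul0r mulrDr mulrDl !mulrA pp ppr.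
  have := congr1 ( *%R^~ p) Jc.
  by rewrite /= mul0r mulrDl ppr pdcp addr0.
have dx : delta x * p = delta x.
  have := J x; rewrite xP Px => Jx.
  have xl := congr1 ( *%R p) Jx; have xr := congr1 ( *%R^~ p) Jx.
  rewrite /= !(mulrDr, mulrDl) !mulrA !(pp, ppr) in xl xr.
  have pd : p * delta x = p * delta x * p by exact: addIr xl.
  have dp : delta x * p = p * delta x * p by exact: addrI xr.
  rewrite pd -dp in Jx.
  apply/eqP; rewrite -subr_eq0; apply/eqP/V2.
  by rewrite addrACA -opprD Jx subrr.
by rewrite APE AE !deltaD !mulrDl da dc dx dbp !addr0.
Qed.

(** Subtracting [D * iota x] and an inner derivation from [delta] reduces to the case where 1 and
    [P] are killed. *)
Lemma weak_jordan_mul_idem (delta : U -> V) P A :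
    {morph delta : A B / A - B} -> weak_jordan delta ->
    P * P = P -> prime_element (iota P) ->
    (forall B C, delta 1 * iota B * iota C = iota C * (delta 1 * iota B)) ->
  delta (A * P) =
    delta A * iota P + iota A * delta P - iota A * delta 1 * iota P.
Proof.
move=> deltaB wjd PP primeP DC.
set p := iota P; set D := delta 1.
have pp : p * p = p by rewrite -rmorphM PP.
have ppr x : x * p * p = x * p by rewrite -mulrA pp.
have DI C : iota C * D = D * iota C.
  by have := DC 1 C; rewrite rmorph1 mulr1.
have pD : p * D = D * p by apply: DI.
pose e := delta P - D * p.
have pe : p * e + e * p = e.
  have := weak_jordan_idem_square delta deltaB wjd P PP.
  rewrite -/p -/D pD => sq; apply/eqP; rewrite -subr_eq0; apply/eqP/V2.
  rewrite /e mulrBr mulrBl !mulrA pD !ppr.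
  apply: (eq_of_subr _ _ _ _ _ sq); non_commutative_ring.
have pep : p * e * p = 0.
  move: (e) pe => x /(congr1 ( *%R p)); rewrite mulrDr !mulrA pp => /eqP.
  by rewrite -subr_eq0 addrAC subrr add0r => /eqP.
(* Since [e = p e + e p] and [p e p = 0], the commutator of [p] with this [t] is [e], which yields
   [d P = 0]. *)
pose t := p * e - e * p.
have pt : p * t - t * p = e.
  rewrite /t; move: (e) pe pep => x px pxp.
  by rewrite mulrBr mulrBl !mulrA pp ppr pxp -[RHS]px; non_commutative_ring.
pose d x := delta x - D * iota x - (iota x * t - t * iota x).
have dB : {morph d : x y / x - y}.
  by move=> x y; rewrite /d deltaB rmorphB; non_commutative_ring.
have d1 : d 1 = 0 by rewrite /d rmorph1; non_commutative_ring.
have dP : d P = 0 by rewrite /d -/p -/e pt subrr.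
(* On a zero product the terms [x D y] and [y D x] vanish, as [D] and [D x] commute with the image
   of [iota]; the inner part satisfies the identity anyway. *)
have dwj : weak_jordan d.
  move=> x y xy.
  have ixy : iota x * iota y = 0 by rewrite -rmorphM xy rmorph0.
  have xDy : iota x * D * iota y = 0 by rewrite DI -mulrA ixy mulr0.
  have yDx : iota y * D * iota x = 0 by rewrite -mulrA -DC -mulrA ixy mulr0.
  have := congr2 +%R (wjd _ _ xy) (congr2 +%R xDy yDx).
  rewrite /jordan_form /d rmorphD !rmorphM => E.
  by apply: (eq_of_subr _ _ _ _ _ E); non_commutative_ring.
have := weak_jordan_peirce d P A dB dwj PP primeP d1 dP.
rewrite /d rmorphM -/p => E.
apply: (eq_of_subr _ _ _ _ _ (congr2 +%R E (congr1 ( *%R (iota A)) pt))).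
rewrite /e; non_commutative_ring.
Qed.

End WeakJordan.

(** * Rank-one operators in Alg L *)

Section RankOne.
Context {F : numFieldType} {X : normedModType F}.

Lemma bounded_op_linear (A : bounded_op X) a x y : A (a *: x + y) = a *: A x + A y.
Proof. by have [+ _] := bounded_opP A; apply. Qed.

Lemma bounded_opB (A : bounded_op X) x y : A (x - y) = A x - A y.
Proof.
by have := bounded_op_linear A (-1) y x; rewrite !scaleN1r ![- _ + _]addrC.
Qed.

Lemma bounded_opZ (A : bounded_op X) a x : A (a *: x) = a *: A x.
Proof.
have A0 : A 0 = 0 by have := bounded_opB A 0 0; rewrite !subrr.
by have := bounded_op_linear A a x 0; rewrite A0 !addr0.
Qed.

Lemma bounded_op_scaleAl a (A B : bounded_op X) : (a *: A) * B = a *: (A * B).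
Proof. exact: bounded_op_ext. Qed.

Lemma bounded_op_scaleAr a (A B : bounded_op X) : A * (a *: B) = a *: (A * B).
Proof. by apply: bounded_op_ext => x; exact: bounded_opZ. Qed.

Lemma bounded_op_double_eq0 (A : bounded_op X) : A + A = 0 -> A = 0.
Proof.
rewrite -mulr2n -scaler_nat => /(congr1 ( *:%R 2%:R^-1)).
by rewrite scalerA mulVf ?pnatr_eq0 // scale1r scaler0.
Qed.

Lemma bounded_op_closure_eq0 (T : bounded_op X) (S : set X) :
  (forall x, S x -> T x = 0) -> forall x, closure S x -> T x = 0.
Proof.
move=> T0 x clx; apply/eqP; apply: contraPT isT => Tx _.
have [_ [K TK]] := bounded_opP T.
have Tx0 : 0 < `|T x| by rewrite normr_gt0.
have K0 : 0 < K.
  have := lt_le_trans Tx0 (TK x).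
  have [->|x0] := eqVneq x 0; first by rewrite normr0 mulr0 ltxx.
  by rewrite pmulr_lgt0 // normr_gt0.
(* The radius is chosen so that [T (x - s)] would be smaller in norm than [T x], although
   [T s = 0]. *)
have [s [Ss]] := clx _ (nbhsx_ballx x (`|T x| / K) (divr_gt0 Tx0 K0)).
rewrite -ball_normE /= ltr_pdivlMr // mulrC => xs.
have := le_lt_trans (TK (x - s)) xs.
by rewrite bounded_opB (T0 _ Ss) subr0 ltxx.
Qed.

Variable L : subspace_lattice X.

Lemma alg_op_member (A : alg_op L) M x : members L M -> M x -> M (A x).
Proof. by move=> LM Mx; have /asboolP := valP A; apply. Qed.

Lemma alg_op_scaleAl a (A B : alg_op L) : (a *: A) * B = a *: (A * B).
Proof. exact/val_inj/bounded_op_scaleAl. Qed.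

Lemma alg_op_scaleAr a (A B : alg_op L) : A * (a *: B) = a *: (A * B).
Proof. exact/val_inj/bounded_op_scaleAr. Qed.

Lemma closed_span_sub (A : set X) : A `<=` closed_span A.
Proof.
move=> x Ax; apply: subset_closure.
by exists 1%N, (fun=> 1), (fun=> x); rewrite big_ord1 scale1r.
Qed.

Lemma lower_member E : members L (lower L E).
Proof. by apply: lattice_join => M []. Qed.

Lemma lower_sub E M : members L M -> ~ E `<=` M -> M `<=` lower L E.
Proof. by move=> LM EM x Mx; apply: closed_span_sub; exists M. Qed.

Definition bounded_functional (f : X -> F) : Prop :=
  (forall a x y, f (a *: x + y) = a * f x + f y) /\
  exists K, forall x, `|f x| <= K * `|x|.

Definition admissible (E : set X) (f : X -> F) : Prop :=
  [/\ members L E, bounded_functional f, forall m, lower L E m -> f m = 0 &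
      exists2 x0, E x0 & f x0 = 1].

Definition elementary (S : alg_op L) : Prop :=
  exists E f x, [/\ admissible E f, E x & forall y, S y = f y *: x].

(** A member [M] either contains [E], hence [x], or lies in [lower L E], where [f] vanishes. *)
Lemma admissible_rank_one E f x : admissible E f -> E x ->
  exists S : alg_op L, forall y, S y = f y *: x.
Proof.
move=> [LE [flin [K fK]] f0 _] Ex.
have bnd : (fun y => f y *: x) \in bounded_op_pred (X := X).
  apply/asboolP; split=> [a u v|]; first by rewrite flin scalerDl scalerA.
  exists (K * `|x|) => y; rewrite normrZ mulrAC ler_wpM2r //.
suff SAlg : BoundedOp bnd \in Alg L by exists (AlgOp SAlg).
apply/asboolP => M LM y My /=.
have [EM|EM] := pselect (E `<=` M).
  have [_ M0 Mlin] := lattice_subspace LM.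
  by have := Mlin (f y) x 0 (EM _ Ex) M0; rewrite addr0.
have [_ M0 _] := lattice_subspace LM.
by rewrite f0 ?scale0r //; exact: (lower_sub _ _ LM EM).
Qed.

Lemma elementary_mull (A S : alg_op L) : elementary S -> elementary (A * S).
Proof.
move=> [E [f [x [Ef Ex SE]]]]; exists E, f, (A x); split=> //.
  by apply: alg_op_member => //; have [] := Ef.
by move=> y; rewrite -bounded_opZ -SE.
Qed.

(** If [f x] is nonzero, [x (x) f] is a multiple of an idempotent; otherwise it is the difference of
    the idempotents [(x + x0) (x) f] and [x0 (x) f]. *)
Lemma elementary_ind (Q : alg_op L -> Prop) :
    (forall a A B, Q A -> Q B -> Q (a *: A + B)) ->
    (forall P, P * P = P -> prime_element (\val P) -> Q P) ->
  forall S, elementary S -> Q S.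
Proof.
move=> Qlin Qidem S [E [f [x [Ef Ex SE]]]].
have [LE [flin _] _ [x0 Ex0 fx0]] := Ef.
have [_ E0 Elin] := lattice_subspace LE.
have f0 : f 0 = 0.
  by have := flin (-1) 0 0; rewrite scaler0 addr0 mulN1r addNr.
have fZ a y : f (a *: y) = a * f y by rewrite -[a *: y]addr0 flin f0 addr0.
have Q1 y (P : alg_op L) : f y = 1 -> (forall z, P z = f z *: y) -> Q P.
  move=> fy PE; apply: Qidem.
    apply/val_inj/bounded_op_ext => z.
    by change (P (P z) = P z); rewrite !PE fZ fy mulr1.
  move=> u v upv.
  have upvE z : f (v z) *: u y = 0.
    by rewrite -bounded_opZ -PE; exact: (congr1 (fun w : bounded_op X => w z) upv).
  have [uy|uy] := eqVneq (u y) 0.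
    left; apply: bounded_op_ext => z.
    by change (u (P z) = 0); rewrite PE bounded_opZ uy scaler0.
  right; apply: bounded_op_ext => z; change (P (v z) = 0); rewrite PE.
  move/eqP: (upvE z); rewrite scaler_eq0 (negPf uy) orbF => /eqP ->.
  by rewrite scale0r.
have [fx|fx] := eqVneq (f x) 0.
  have [P0 P0E] := admissible_rank_one _ _ _ Ef Ex0.
  have Exx0 : E (x + x0) by have := Elin 1 _ _ Ex Ex0; rewrite scale1r.
  have [P1 P1E] := admissible_rank_one _ _ _ Ef Exx0.
  have -> : S = (-1) *: P0 + P1.
    apply/val_inj/bounded_op_ext => z.
    change (S z = (-1) *: P0 z + P1 z).
    by rewrite SE P0E P1E scaleN1r scalerDr addrC addrK.
  apply: Qlin; first exact: (Q1 x0).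
  apply: (Q1 (x + x0)) => //.
  by rewrite -[x]scale1r flin fx fx0 mulr0 add0r.
have Ex1 : E ((f x)^-1 *: x) by have := Elin (f x)^-1 _ _ Ex E0; rewrite addr0.
have [P PE] := admissible_rank_one _ _ _ Ef Ex1.
have QP : Q P by apply: (Q1 _ _ _ PE); rewrite fZ mulVf.
(* [S] is [f x *: P], written in the form that [Qlin] accepts from [Q P] alone. *)
have -> : S = (f x - 1) *: P + P.
  apply/val_inj/bounded_op_ext => z; change (S z = (f x - 1) *: P z + P z).
  rewrite scalerBl scale1r subrK PE SE !scalerA.
  by rewrite [f x * f z]mulrC mulfK.
exact: Qlin.
Qed.

(** For [v] in a member [E] of [PL L], separate some [x0] in [E] from [lower L E] by [f]; evaluating
    [T (v (x) f)] at [x0] gives [T v = 0]. *)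
Lemma elementary_separation (T : bounded_op X) :
    functional_separation F -> closed_span (\bigcup_(M in PL L) M) = [set: X] ->
  (forall S, elementary S -> T * \val S = 0) -> T = 0.
Proof.
move=> sep hL TS; apply: bounded_op_ext => x.
have : closed_span (\bigcup_(M in PL L) M) x by rewrite hL.
apply: bounded_op_closure_eq0 => _ [n [c [v [vPL ->]]]].
have Tv i : T (v i) = 0.
  have [E [LE /existsNP[x0 /not_implyP[Ex0 nx0]]] Ev] := vPL i.
  have [f [flin fK f0 fx0]] := sep _ _ _ (lattice_subspace (lower_member E)) nx0.
  have Ef : admissible E f by split=> //; exists x0.
  have [S SE] := admissible_rank_one _ _ _ Ef Ev.
  have /TS TS0 : elementary S by exists E, f, (v i).
  have := congr1 (fun w : bounded_op X => w x0) TS0.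
  by change (T (S x0) = 0 -> T (v i) = 0); rewrite SE fx0 scale1r.
elim/big_ind: _ => [|y z Ty Tz|i _].
- by have := bounded_opB T 0 0; rewrite !subrr.
- by rewrite -[y]scale1r bounded_op_linear Ty Tz scaler0 addr0.
- by rewrite bounded_opZ Tv scaler0.
Qed.

End RankOne.

(** * From elementary operators to the whole algebra *)

Section Main.
Variables (F : numFieldType) (X : normedModType F) (L : subspace_lattice X).
Hypothesis sep : functional_separation F.
Hypothesis hL : closed_span (\bigcup_(M in PL L) M) = [set: X].
Variable delta : {linear alg_op L -> bounded_op X}.
Let D := delta 1.

Let emb : {rmorphism alg_op L -> bounded_op X} := \val.

Let deltaB : {morph delta : A B / A - B}.
Proof. exact: raddfB. Qed.

Let valM (A B : alg_op L) : \val (A * B) = \val A * \val B.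
Proof. by []. Qed.

Lemma WJD_elementary_comm (S : alg_op L) : WJD delta -> elementary L S ->
  D * \val S = \val S * D /\
  forall A : alg_op L, D * \val (A * S) = D * \val (S * A).
Proof.
move=> wjd; move: S; apply: elementary_ind => [a A B [DA IA] [DB IB]|P PP _].
  split.
    change (D * (a *: \val A + \val B) = (a *: \val A + \val B) * D).
    by rewrite mulrDr mulrDl bounded_op_scaleAr bounded_op_scaleAl DA DB.
  move=> C; rewrite mulrDr mulrDl alg_op_scaleAr alg_op_scaleAl.
  change (D * (a *: \val (C * A) + \val (C * B)) =
          D * (a *: \val (A * C) + \val (B * C))).
  by rewrite !mulrDr !bounded_op_scaleAr IA IB.
have double := @bounded_op_double_eq0 F X.
split; first exact: (weak_jordan_idem_comm emb delta deltaB wjd).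
by move=> A; exact: (weak_jordan_corner_comm emb double delta deltaB wjd).
Qed.

(** For [S] elementary, so is [C S], and both sides times [S] reduce to [C S D A]. *)
Lemma WJD_comm (A C : alg_op L) : WJD delta ->
  D * \val A * \val C = \val C * (D * \val A).
Proof.
move=> wjd; apply/eqP; rewrite -subr_eq0; apply/eqP.
apply: (elementary_separation L) => // S eS.
have [DS SA] := WJD_elementary_comm S wjd eS.
have [DCS CSA] := WJD_elementary_comm (C * S) wjd (elementary_mull _ _ _ eS).
have {}SA : D * \val A * \val S = \val S * D * \val A.
  by rewrite -DS -mulrA -valM SA valM mulrA.
have {}CSA : D * \val A * (\val C * \val S) = \val C * \val S * D * \val A.
  by rewrite -[\val C * _]valM -DCS -mulrA -valM CSA valM mulrA.
rewrite mulrBl -[X in X - _]mulrA CSA -[\val C * _ * \val S]mulrA SA.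
by rewrite !mulrA subrr.
Qed.

Lemma WJD_generalized_derivation : WJD delta -> generalized_derivation delta.
Proof.
move=> wjd.
have inj : injective emb := val_inj.
have double := @bounded_op_double_eq0 F X.
have E (S : alg_op L) : elementary L S -> forall A, delta (A * S) =
    delta A * \val S + \val A * delta S - \val A * D * \val S.
  move: S; apply: elementary_ind => [a B C EB EC A|P PP primeP A].
    rewrite mulrDr alg_op_scaleAr !linearP EB EC.
    change (\val (a *: B + C)) with (a *: \val B + \val C).
    rewrite !mulrDr !bounded_op_scaleAr !scalerDr scalerN.
    by rewrite [LHS]addrACA -opprD [X in X - _]addrACA.
  apply: (weak_jordan_mul_idem emb double inj delta P A deltaB wjd PP primeP).
  by move=> B C; exact: WJD_comm.
move=> A B; apply/eqP; rewrite -subr_eq0; apply/eqP.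
apply: (elementary_separation L) => // S eS.
have eBS := elementary_mull _ B _ eS.
have := E _ eS (A * B); rewrite -mulrA (E _ eBS) (E _ eS B).
by rewrite !valM => /esym; exact: generalized_derivation_defect.
Qed.

End Main.

Lemma functional_separation_real_or_complex (R : realType) (F : numFieldType) :
  F = (R : numFieldType) \/ F = (R[i] : numFieldType) -> functional_separation F.
Proof.
case=> ->.
  exact: functional_separation_real.
exact: functional_separation_complex.
Qed.

Theorem theorem3p2 (R : realType) (F : numFieldType)
    (hF : F = (R : numFieldType) \/ F = (R[i] : numFieldType))
    (X : completeNormedModType F) (L : subspace_lattice X)
    (hL : closed_span (\bigcup_(M in PL L) M) = [set: X])
    (delta : {linear alg_op L -> bounded_op X}) :
  (WJD delta <->
     generalized_derivation delta /\
     forall A : alg_op L, commutant (Alg L) (delta 1 * \val A)) /\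
  (delta 1 = 0 -> (WJD delta <-> derivation delta)).
Proof.
have sep := functional_separation_real_or_complex R F hF.
have main : WJD delta <-> generalized_derivation delta /\
    forall A : alg_op L, commutant (Alg L) (delta 1 * \val A).
  split=> [wjd|[gd comm] A B AB].
    split; first exact: WJD_generalized_derivation.
    move=> A C CAlg; exact: (WJD_comm _ _ L sep hL delta A (AlgOp CAlg)).
  have valAB : \val A * \val B = 0 by rewrite -[LHS]/(\val (A * B)) AB.
  have comm1 (C : alg_op L) : delta 1 * \val C = \val C * delta 1.
    by have := comm 1 (\val C) (valP C); rewrite [\val 1]/(1 : bounded_op X) mulr1.
  have valD (C E : alg_op L) : \val C * delta 1 * \val E = delta 1 * \val C * \val E.
    by rewrite -comm1.
  (* [D B] commutes with [A] and [D] with [A], so [D B A = A D B = D A B = 0]. *)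
  have DBA : delta 1 * \val B * \val A = 0.
    by rewrite (comm B _ (valP A)) mulrA -comm1 -mulrA valAB mulr0.
  rewrite AB add0r gd valD DBA subr0.
  (* As [delta (A * B) = 0], the terms [delta A * B + A * delta B] cancel, leaving the expansion of
     [delta (B * A)]. *)
  have := gd A B; rewrite AB raddf0 valD -mulrA valAB mulr0 subr0 => <-.
  by rewrite add0r.
split=> // d1; rewrite main; split=> [[gd _] A B|der].
  by rewrite gd d1 mulr0 mul0r subr0.
split=> [A B|A C _]; last by rewrite d1 !mul0r mulr0.
by rewrite der d1 mulr0 mul0r subr0.
Qed.
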